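(* Let $F$ be a complete alternating shape with $n$ pipes. Then for any permutation $\omega\in\mathfrak S_n$, every acyclic pipe dream in $\Pi_F(\omega)$ is also strongly acyclic.
   Context: Grid cells are unit squares with corners in $\mathbb Z^2$, indexed by their lower-left corner. An alternating shape $F$ (with parameter $n\ge 2$) is a connected finite set of cells whose boundary splits into four paths: a starting path from $(0,0)$ made of $n$ unit steps, each south or east; a NW stair path from $(0,0)$ to $(t_F,t_F)$ with steps $(NE)^{t_F}$, $t_F\ge 0$; an ending path from $(t_F,t_F)$ made of $n$ unit steps, each south or east; and a SE stair path from the endpoint of the starting path to the endpoint of the ending path with steps $(EN)^{b}$, $b\ge0$; the ending path stays strictly north and east of the starting path. A pipe dream on $F$ fills each cell with either a cross (one pipe passing straight horizontally, one straight vertically) or a contact (one elbow joining the west side to the north side, called the NW elbow, and one joining the south side to the east side, called the SE elbow), so that the $n$ pipes entering through the $n$ unit steps of the starting path exit through the $n$ unit steps of the ending path. Pipes are labelled $1,\dots,n$ by their entry step, from northwest to southeast along the starting path; the exit permutation $\omega$ is given by: $\omega(i)$ is the pipe exiting through the $i$-th step of the ending path (counted from northwest to southeast). A pipe dream is reduced if any two pipes cross at most once. $\Pi_F(\omega)$ is the set of reduced pipe dreams on $F$ with exit permutation $\omega$; $\omega$ is sortable on $F$ if $\Pi_F(\omega)\neq\emptyset$. $F$ is complete if the longest permutation $\omega_0=n\,(n-1)\cdots 2\,1$ is sortable on $F$. For $a<b$, $(a,b)$ is a noninversion of $\omega$ if $\omega^{-1}(a)<\omega^{-1}(b)$. The contact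 graph of $P$ is the directed graph on $\{1,\dots,n\}$ with an arc $a\to b$ iff some contact cell of $P$ has pipe $a$ on its NW elbow and pipe $b$ on its SE elbow; $P$ is acyclic if its contact graph is acyclic. The extended contact graph is obtained by adding all arcs $a\to b$ with $(a,b)$ a noninversion of $\omega$; $P$ is strongly acyclic if its extended contact graph is acyclic. *)

(* Defs.v *)
From HB Require Import structures.
From Stdlib Require Import Relation_Operators.
From mathcomp Require Import all_boot all_order all_fingroup all_algebra.
From mathcomp Require Import finmap.

Set Implicit Arguments.
Unset Strict Implicit.
Unset Printing Implicit Defensive.

Local Open Scope ring_scope.

(* A lattice point; also the unit cell having it as lower-left corner. *)
Definition point := (int * int)%type.
Definition origin : point := (0, 0).

(* Unit edges, named by their lower or left endpoint: [Hor (x, y)] joins (x, y)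
   to (x + 1, y) and [Ver (x, y)] joins (x, y) to (x, y + 1). *)
Inductive edge := Hor of point | Ver of point.

Definition sum_of_edge (e : edge) : point + point :=
  match e with Hor p => inl p | Ver p => inr p end.
Definition edge_of_sum (s : point + point) : edge :=
  match s with inl p => Hor p | inr p => Ver p end.
Lemma sum_of_edgeK : cancel sum_of_edge edge_of_sum.
Proof. by case. Qed.
HB.instance Definition _ := Equality.copy edge (can_type sum_of_edgeK).

Definition west_side (c : point) : edge := Ver c.
Definition south_side (c : point) : edge := Hor c.
Definition east_side (c : point) : edge := Ver (c.1 + 1, c.2).
Definition north_side (c : point) : edge := Hor (c.1, c.2 + 1).

(* The two cells adjacent to an edge: the one north or east of it, and the one
   south or west of it. *)
Definition cell_after (e : edge) : point :=
  match e with Hor p => p | Ver p => p end.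
Definition cell_before (e : edge) : point :=
  match e with Hor p => (p.1, p.2 - 1) | Ver p => (p.1 - 1, p.2) end.

Inductive dir := North | East | South.

Definition is_SE (d : dir) : bool :=
  match d with North => false | East | South => true end.

Definition move (p : point) (d : dir) : point :=
  match d with
  | North => (p.1, p.2 + 1)
  | East => (p.1 + 1, p.2)
  | South => (p.1, p.2 - 1)
  end.

Definition step_edge (p : point) (d : dir) : edge :=
  match d with
  | North => Ver p
  | East => Hor p
  | South => Ver (p.1, p.2 - 1)
  end.

Definition vertex (p : point) (ds : seq dir) (k : nat) : point :=
  foldl move p (take k ds).
Definition endpoint (p : point) (ds : seq dir) : point := foldl move p ds.
Fixpoint path_edges (p : point) (ds : seq dir) : seq edge :=
  if ds is d :: ds' then step_edge p d :: path_edges (move p d) ds' else [::].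

Definition NE_stairs (t : nat) : seq dir := flatten (nseq t [:: North; East]).
Definition EN_stairs (b : nat) : seq dir := flatten (nseq b [:: East; North]).

Definition in_boundary (F : {fset point}) (e : edge) : bool :=
  (cell_after e \in F) (+) (cell_before e \in F).

Definition adjacent : rel point := fun c d =>
  d \in [:: (c.1 + 1, c.2); (c.1 - 1, c.2); (c.1, c.2 + 1); (c.1, c.2 - 1)].

Definition connected_cells (F : {fset point}) : Prop :=
  forall c d, c \in F -> d \in F ->
    exists p : seq point,
      [/\ path adjacent c p, last c p = d & all (fun x => x \in F) p].

Record alternating_shape (n : nat) := AlternatingShape {
  cells :> {fset point};
  start_steps : seq dir;
  end_steps : seq dir;
  NW_height : nat;
  SE_height : nat;
  start_point := origin;
  end_start_point : point := (NW_height%:Z, NW_height%:Z);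
  start_end_point := endpoint start_point start_steps;
  cells_connected : connected_cells cells;
  size_start : size start_steps = n;
  size_end : size end_steps = n;
  start_SE : all is_SE start_steps;
  end_SE : all is_SE end_steps;
  paths_close :
    endpoint start_end_point (EN_stairs SE_height)
      = endpoint end_start_point end_steps;
  (* After k steps both paths are on the same line x - y = k, so comparing the
     k-th vertices compares the two paths. Their extremities are compared by
     the stairs, and coincide when the stair is empty. *)
  end_above_start : forall k : nat, (0 < k < n)%N ->
    (vertex start_point start_steps k).1 < (vertex end_start_point end_steps k).1
    /\ (vertex start_point start_steps k).2
         < (vertex end_start_point end_steps k).2;
  boundaryE : forall e : edge,
    in_boundary cells e
      = (e \in path_edges start_point start_steps
               ++ path_edges start_point (NE_stairs NW_height)
               ++ path_edges end_start_point end_steps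
               ++ path_edges start_end_point (EN_stairs SE_height))
}.

Section PipeDreams.
Variables (n : nat) (F : alternating_shape n).

Definition start_edge (i : 'I_n) : edge :=
  nth (Hor origin) (path_edges (start_point F) (start_steps F)) i.
Definition end_edge (i : 'I_n) : edge :=
  nth (Hor origin) (path_edges (end_start_point F) (end_steps F)) i.

Inductive tile := Cross | Contact.

(* Fillings are total functions on Z^2; only their values on the cells of F are
   ever used. *)
Definition filling := point -> tile.

Implicit Types (P : filling) (w : 'S_n) (i j a b : 'I_n) (c : point).

(* The edge through which a pipe entering the cell [cell_after e] through its
   west or south side e leaves this cell. *)
Definition next_edge P (e : edge) : edge :=
  match e with
  | Ver c => if P c is Cross then east_side c else north_side c
  | Hor c => if P c is Cross then north_side c else east_side c
  end.

(* [on_pipe P i e]: the pipe entering through the i-th step of the starting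
   path traverses the edge e. *)
Inductive on_pipe P i : edge -> Prop :=
| on_pipe_start : on_pipe P i (start_edge i)
| on_pipe_next e :
    on_pipe P i e -> cell_after e \in cells F -> on_pipe P i (next_edge P e).

Definition exit_permutation P w : Prop :=
  forall i, on_pipe P (w i) (end_edge i).

Definition cross_at P i j c : Prop :=
  [/\ c \in cells F, P c = Cross &
      (on_pipe P i (west_side c) /\ on_pipe P j (south_side c))
      \/ (on_pipe P j (west_side c) /\ on_pipe P i (south_side c))].

Definition reduced P : Prop :=
  forall i j c c', i <> j -> cross_at P i j c -> cross_at P i j c' -> c = c'.

(* Pi_F(w); the existence of an exit permutation says in particular that all
   the pipes leave F through the ending path. *)
Definition reduced_pipe_dream w P : Prop := exit_permutation P w /\ reduced P.

Definition sortable w : Prop := exists P, reduced_pipe_dream w P.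

Definition longest_perm : 'S_n := perm (@rev_ord_inj n).

Definition complete : Prop := sortable longest_perm.

Definition noninversion w a b : Prop :=
  (a < b)%N /\ ((w^-1)%g a < (w^-1)%g b)%N.

(* West sides belong to NW elbows and south sides to SE elbows. *)
Definition contact_arc P a b : Prop :=
  exists c, [/\ c \in cells F, P c = Contact,
                on_pipe P a (west_side c) & on_pipe P b (south_side c)].

Definition extended_contact_arc P w a b : Prop :=
  contact_arc P a b \/ noninversion w a b.

Definition acyclic_digraph (T : Type) (R : T -> T -> Prop) : Prop :=
  forall x, ~ clos_trans T R x x.

Definition acyclic P : Prop := acyclic_digraph (contact_arc P).

Definition strongly_acyclic P w : Prop :=
  acyclic_digraph (extended_contact_arc P w).

End PipeDreams.

(* Main.v *)
Require Import Defs.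
From mathcomp Require Import all_boot all_fingroup.
From Stdlib Require Import Relation_Operators ClassicalEpsilon.
From mathcomp Require Import all_order all_algebra finmap zify.

(** For every noninversion [(a, b)] of [w] the contact graph of [P] has a path
    from [a] to [b]; hence the extended contact graph has the same transitive
    closure as the contact graph.

    Suppose there is no such path, and let [A] be the set of pipes reachable from
    [a]. Sweep [F] by southeast fronts moving from the starting to the ending
    path. For a vertex [V] of the starting path and a vertex [X] of the front,
    the number of pipes starting southeast of [V] and passing northwest of [X] is
    at most a capacity depending only on [V] and [X], since a northeast lattice
    path from [V] to [X] is crossed from right to left only through its east
    steps. Call [(V, X)] tight for [P] if equality holds. As no contact has a
    pipe of [A] on its NW elbow and one outside [A] on its SE elbow, the sweep
    preserves: any pipe of [A] which is northwest of a pipe outside [A], both at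
    the start and on the front, is separated from it by a tight pair. At the
    end, [a] and [b] are thus separated by a tight pair [(V, X)]; but a
    pipe dream of the longest permutation sends strictly more pipes from the
    right of [V] to the left of [X] than [P] does, exceeding the capacity. *)

Set Implicit Arguments.
Unset Strict Implicit.
Unset Printing Implicit Defensive.

(** * Separation of pipes by tight pairs *)

(* [sg i] is the pipe at position [i] of a front; gap [j] lies between positions
   [j - 1] and [j]. *)
Definition separated (sg : nat -> nat) (T : nat -> nat -> bool) (m m' : nat) : Prop :=
  exists l j, [/\ T l j, sg m < l <= sg m' & m < j <= m'].

Definition separating (n : nat) (sg : nat -> nat) (A : pred nat) (T : nat -> nat -> bool) : Prop :=
  forall m m', m < m' -> m' < n -> sg m < sg m' -> A (sg m) -> ~~ A (sg m') ->
    separated sg T m m'.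

Definition empty_box (sg : nat -> nat) (l l' j j' : nat) : Prop :=
  forall i, j <= i < j' -> ~~ (l <= sg i < l').

(** Serves to trade a tight pair [(l, k)] for one at a gap further right, with a vertex still at
    least [l] instead of merely exceeding [sg k]. The hypothesis on empty boxes is the form in which
    uncrossing of tight pairs enters. *)
Lemma separating_right n sg A T k l q :
    separating n sg A T ->
    (forall l2 m, T l2 m -> 0 < l2 < l -> k < m < n -> empty_box sg l2 l k m -> T l m) ->
    k < q < n -> sg k < l <= sg q -> A (sg k) -> ~~ A (sg q) ->
  exists l' m, [/\ T l' m, l <= l' <= sg q & k < m <= q].
Proof.
move=> sepT unc kq; rewrite andbC => /andP[lq skl] Ak nAq.
(* Induction on [sg r], replacing [k] by a position [r] to its right; for fixed
   [r], the separating gap [m] of [r] and [q] is taken minimal. A pipe in the box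
   obstructing [unc] would contradict this minimality if outside [A], and
   otherwise gives the next [r]. *)
suff gen d r : l - sg r < d -> k <= r < q -> sg r < l -> A (sg r) ->
    (forall i, k <= i < r -> sg r < sg i < l -> A (sg i)) ->
    exists l' m, [/\ T l' m, l <= l' <= sg q & k < m <= q].
  by apply: (gen (l - sg k).+1 k) => //; try lia; move=> i; lia.
elim: d r => // d IH r lt_d krq srl Ar inv.
have [l0 [m0 [Tlm lP mP]]] := sepT r q ltac:(lia) ltac:(lia) ltac:(lia) Ar nAq.
elim/ltn_ind: m0 l0 mP Tlm lP => m IHm l' mP Tlm lP.
have [ll'|l'l] := leqP l l'; first by exists l', m; split=> //; lia.
have [/hasP[g]|/hasPn noB] :=
  boolP (has (fun g => (l' <= sg g < l) && ~~ A (sg g)) (iota k (m - k))).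
  rewrite mem_iota => gP /andP[sgP nAg].
  have rg : r < g.
    have [//|gr|rg] := ltngtP r g; last by move: sgP; rewrite -rg; lia.
    by move: nAg; rewrite (inv g) //; lia.
  have [l1 [m1 [T1 l1P m1P]]] := sepT r g rg ltac:(lia) ltac:(lia) Ar nAg.
  by apply: (IHm m1 _ l1) => //; lia.
have [/hasP[g]|/hasPn noA] := boolP (has (fun g => l' <= sg g < l) (iota k (m - k))).
  move=> gI sgP; have := noB g gI; rewrite sgP negbK /= => Ag.
  rewrite mem_iota in gI; apply: (IH g) => //; try lia.
  move=> i iP siP; have := noB i; rewrite mem_iota negb_and negbK.
  by move=> /(_ ltac:(lia)) /orP[|//]; lia.
exists l, m; split; [|lia|lia].
apply: (unc l' m) => //; try lia.
by move=> i iP; apply: noA; rewrite mem_iota; lia.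
Qed.

(** Follows from [separating_right] by the half-turn sending positions and pipes [i] to [n - 1 - i]
    and gaps [v] to [n - v]. It exchanges [A] with its complement. *)
Lemma separating_left n sg A T k l p :
    (forall i, i < n -> sg i < n) -> separating n sg A T ->
    (forall l2 m, T l2 m -> l < l2 < n -> 0 < m <= k -> empty_box sg l l2 m k.+1 -> T l m) ->
    p < k < n -> sg p < l <= sg k -> A (sg p) -> ~~ A (sg k) ->
  exists l' m, [/\ T l' m, sg p < l' <= l & p < m <= k].
Proof.
move=> sg_n sepT unc pk lP Ap nAk.
pose sg' i := n.-1 - sg (n.-1 - i).
pose A' x := ~~ A (n.-1 - x).
pose T' u v := T (n - u) (n - v).
have sgK i : i < n -> n.-1 - sg' i = sg (n.-1 - i).
  by move=> ilt; rewrite /sg'; have := sg_n (n.-1 - i) ltac:(lia); lia.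
have sgk := sg_n k ltac:(lia); have sgp := sg_n p ltac:(lia).
have kE : n.-1 - (n.-1 - k) = k by lia.
have pE : n.-1 - (n.-1 - p) = p by lia.
have [||||||u [v [Tuv uP vP]]] := @separating_right n sg' A' T' (n.-1 - k) (n - l) (n.-1 - p).
- move=> m m' mm' m'n sgm; rewrite /A' !sgK ?negbK; try lia.
  move=> nAm Am'.
  have := sgK m ltac:(lia); have := sgK m' ltac:(lia).
  have := sg_n (n.-1 - m) ltac:(lia); have := sg_n (n.-1 - m') ltac:(lia).
  move: sgm; rewrite /sg' => sgm h1 h2 h3 h4.
  have [u [v [Tuv uP vP]]] := sepT (n.-1 - m') (n.-1 - m) ltac:(lia) ltac:(lia) ltac:(lia) Am' nAm.
  exists (n - u), (n - v); split; [|lia|lia].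
  rewrite /T'; have -> : n - (n - u) = u by lia.
  by have -> : n - (n - v) = v by lia.
- move=> l2 m Tlm l2l mP box; rewrite /T'.
  have -> : n - (n - l) = l by lia.
  apply: (unc (n - l2)) => //; try lia.
  move=> i iP; have := box (n.-1 - i) ltac:(lia); rewrite /sg'.
  have -> : n.-1 - (n.-1 - i) = i by lia.
  have := sg_n i ltac:(lia); lia.
- lia.
- by rewrite /sg' kE pE; lia.
- by rewrite /A' sgK ?kE //; lia.
- by rewrite /A' sgK ?pE ?negbK //; lia.
move: uP; rewrite /sg' pE => uP.
by exists (n - u), (n - v); split=> //; lia.
Qed.

(** Sweeping a cell moves only vertex [r.+1] of the front, so tightness survives at every other gap.
    Hence each pair still to be separated needs a tight gap other than [r.+1]; only the two pipes at
    the cell itself are excepted. *)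
Lemma separated_avoiding n sg A T r m m' :
    (forall i, i < n -> sg i < n) -> separating n sg A T -> r.+1 < n ->
    (forall l, T l r.+1 -> sg r < l -> T l r) ->
    (forall l, T l r.+1 -> l <= sg r.+1 -> T l r.+2) ->
    (forall l l2 j j2, T l2 j2 -> T l j -> l2 < l < n -> j < j2 < n ->
       empty_box sg l2 l j j2 -> T l j2 /\ T l2 j) ->
    (sg r.+1 < sg r -> A (sg r) -> A (sg r.+1)) ->
    m < m' -> m' < n -> sg m < sg m' -> A (sg m) -> ~~ A (sg m') ->
    ~ (m = r /\ m' = r.+1) ->
  exists l j, [/\ T l j, sg m < l <= sg m', m < j <= m' & j <> r.+1].
Proof.
move=> sg_n sepT rn moveN moveE unc ordA mm' m'n sgm Am nAm' mr.
have [l [j [Tlj lP jP]]] := sepT m m' mm' m'n sgm Am nAm'.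
have [jr|jr] := eqVneq j r.+1; last by exists l, j; split=> //; exact/eqP.
subst j; have sgm' := sg_n m' m'n.
(* If [sg r.+1] is in [A] and below [l], or [sg r] is outside [A] and at least [l], uncrossing moves
   the gap right or left. In the remaining cases the gap shifts by one step along the front. *)
have right : r.+1 < m' -> sg r.+1 < l -> A (sg r.+1) ->
    exists l j, [/\ T l j, sg m < l <= sg m', m < j <= m' & j <> r.+1].
  move=> rm' srl Ar.
  have [|//||//|//|l' [j [T' l'P j'P]]] := @separating_right n sg A T r.+1 l m' sepT; try lia.
    by move=> l2 j2 T2 l2l j2P box; have [] := unc l l2 r.+1 j2 T2 Tlj ltac:(lia) j2P box.
  by exists l', j; split=> //; lia.
have left : m < r -> l <= sg r -> ~~ A (sg r) ->
    exists l j, [/\ T l j, sg m < l <= sg m', m < j <= m' & j <> r.+1].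
  move=> rm' srl Ar.
  have [|//||//|//|l' [j [T' l'P j'P]]] := @separating_left n sg A T r l m sg_n sepT; try lia.
    move=> l2 j2 T2 l2l j2P box.
    by have [] := unc l2 l j2 r.+1 Tlj T2 l2l ltac:(lia) box.
  by exists l', j; split=> //; lia.
(* Only gap [r.+1] lies between positions [r] and [r.+1], so separating them supplies another vertex
   [l1] tight at this same gap. *)
have pair : sg r < sg r.+1 -> A (sg r) -> ~~ A (sg r.+1) ->
    exists2 l1, T l1 r.+1 & sg r < l1 <= sg r.+1.
  move=> sr Ar nAr; have [l1 [j1 [T1 l1P j1P]]] := sepT r r.+1 (ltnSn _) rn sr Ar nAr.
  by exists l1 => //; have <- : j1 = r.+1 by lia.
have neq : A (sg r) -> ~~ A (sg r.+1) -> sg r < sg r.+1.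
  move=> Ar nAr; have [//|sr|sE] := ltngtP (sg r) (sg r.+1).
    by rewrite ordA in nAr.
  by rewrite -sE Ar in nAr.
have [m'E|rm'] := eqVneq m' r.+1.
  subst m'; have mr' : m < r by lia.
  have [srl|lsr] := ltnP (sg r) l.
    by exists l, r; split; [exact: moveN | | lia | lia].
  have [Ar|nAr] := boolP (A (sg r)); last exact: left.
  have [l1 T1 l1P] := pair (neq Ar nAm') Ar nAm'.
  by exists l1, r; split; [apply: moveN => //; lia | lia | lia | lia].
have [lsr|srl] := leqP l (sg r.+1).
  by exists l, r.+2; split; [exact: moveE | | lia | lia].
have [Ar1|nAr1] := boolP (A (sg r.+1)); first by apply: right => //; lia.
have [mE|mr'] := eqVneq m r.
  subst m; have [l1 T1 l1P] := pair (neq Am nAr1) Am nAr1.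
  by exists l1, r.+2; split; [apply: moveE => //; lia | lia | lia | lia].
have [srl'|lsr] := ltnP (sg r) l.
  by exists l, r; split; [exact: moveN | | lia | lia].
have nAr : ~~ A (sg r) by apply: contra nAr1; apply: ordA; lia.
by apply: left => //; lia.
Qed.

Import Order.TTheory GRing.Theory Num.Theory.

Local Open Scope ring_scope.

(** * Coordinates and cells of an alternating shape *)

(* A path of south and east steps is encoded by the abscissas [x k] of its
   vertices [(x k, x k - k)]. *)
Definition is_front (n : nat) (x : nat -> int) : Prop :=
  forall k, (k < n)%N -> x k.+1 = x k \/ x k.+1 = x k + 1.

Definition front_edge (x : nat -> int) (i : nat) : edge :=
  if x i.+1 == x i then Ver (x i, x i - i.+1%:Z) else Hor (x i, x i - i%:Z).

Lemma front_range n x (xP : is_front n x) k m :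
  (k <= m <= n)%N -> x k <= x m <= x k + m%:Z - k%:Z.
Proof.
elim: m => [|m IH] /andP[].
  by rewrite leqn0 => /eqP -> _; lia.
rewrite leq_eqVlt => /orP[/eqP -> _|km mn]; first lia.
have := IH ltac:(lia); have := xP m mn; lia.
Qed.

(** The least value of [x - y] on the edge, which is the index of the only step it can occupy in a
    front. *)
Definition edge_gap (e : edge) : int :=
  match e with Ver p => p.1 - p.2 - 1 | Hor p => p.1 - p.2 end.

Lemma vertexS p ds k : (k < size ds)%N ->
  vertex p ds k.+1 = move (vertex p ds k) (nth East ds k).
Proof. by move=> kds; rewrite /vertex (take_nth East) // foldl_rcons. Qed.

Lemma vertex_SE p ds k : all is_SE ds -> (k <= size ds)%N ->
  (vertex p ds k).2 = (vertex p ds k).1 - p.1 + p.2 - k%:Z.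
Proof.
move=> dsP; elim: k => [|k IH] kds; first by rewrite /vertex take0 /=; lia.
rewrite vertexS //; have /(all_nthP East) /(_ k kds) := dsP.
by case: nth => //= _; have := IH (ltnW kds); lia.
Qed.

Lemma size_path_edges p ds : size (path_edges p ds) = size ds.
Proof. by elim: ds p => //= d ds IH p; rewrite IH. Qed.

Lemma nth_path_edges p ds i e0 : (i < size ds)%N ->
  nth e0 (path_edges p ds) i = step_edge (vertex p ds i) (nth East ds i).
Proof. by elim: ds p i => //= d ds IH p [|i] //= ids; rewrite IH. Qed.

Lemma SE_front p ds : all is_SE ds -> is_front (size ds) (fun k => (vertex p ds k).1).
Proof.
move=> dsP k kds; rewrite vertexS //.
by have /(all_nthP East) /(_ k kds) := dsP; case: nth => //= _; [right|left].
Qed.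

Lemma nth_SE_path p ds i e0 : all is_SE ds -> p.1 = p.2 -> (i < size ds)%N ->
  nth e0 (path_edges p ds) i = front_edge (fun k => (vertex p ds k).1) i.
Proof.
move=> dsP pE ids; rewrite nth_path_edges // /front_edge vertexS //.
have /(all_nthP East) /(_ i ids) := dsP.
have := vertex_SE p dsP (ltnW ids); rewrite pE; case: vertex => a b /= bE.
by case: nth => //= _; rewrite ?eqxx ?ifN; try lia; do 2!f_equal; lia.
Qed.

Lemma NE_stairs_gap t p e :
  e \in path_edges p (NE_stairs t) -> edge_gap e = p.1 - p.2 - 1.
Proof.
elim: t p => //= t IH p; rewrite !inE => /orP[/eqP ->|/orP[/eqP ->|/IH]] //=; lia.
Qed.

Lemma EN_stairs_gap t p e :
  e \in path_edges p (EN_stairs t) -> edge_gap e = p.1 - p.2.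
Proof.
elim: t p => //= t IH p; rewrite !inE => /orP[/eqP ->|/orP[/eqP ->|/IH]] //=; lia.
Qed.

Lemma endpoint_EN_stairs b p :
  endpoint p (EN_stairs b) = (p.1 + b%:Z, p.2 + b%:Z).
Proof.
elim: b p => [|b IH] p /=; first by rewrite !addr0; case: p.
rewrite [LHS]IH /=; congr pair; lia.
Qed.

Lemma front_edge_gap x i : edge_gap (front_edge x i) = i%:Z.
Proof. by rewrite /front_edge; case: ifP => _ /=; lia. Qed.

Lemma front_edge_VerP x i p : front_edge x i = Ver p -> x i = p.1 /\ x i.+1 = p.1.
Proof. by rewrite /front_edge; case: eqP => // xE [<-] /=; split. Qed.

Lemma front_edge_HorP n x i p : is_front n x -> (i < n)%N ->
  front_edge x i = Hor p -> x i = p.1 /\ x i.+1 = p.1 + 1.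
Proof.
move=> xP ilt; rewrite /front_edge; case: eqP => // xE [<-] /=; split=> //.
by have [] := xP i ilt.
Qed.

Lemma front_edge_Ver x i : x i.+1 = x i -> front_edge x i = Ver (x i, x i - i.+1%:Z).
Proof. by rewrite /front_edge => ->; rewrite eqxx. Qed.

Lemma front_edge_Hor x i : x i.+1 = x i + 1 -> front_edge x i = Hor (x i, x i - i%:Z).
Proof. by rewrite /front_edge => ->; case: eqP => //; lia. Qed.

(** A descent starting in [S] would stay in [S] and lower [f] forever, but [f] is bounded below on a
    finite set. This turns an infinite walk meeting no boundary edge into the absence of cells. *)
Lemma fset_descent (S : {fset point}) (Q : point -> Prop) (f : point -> int) :
  (forall c, Q c -> exists d, [/\ Q d, f d < f c & (c \in S) = (d \in S)]) ->
  forall c, Q c -> c \notin S.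
Proof.
move=> descQ c Qc; apply/negP => cS.
pose B := (\sum_(d <- S) `|f d|)%N.
have fB d : d \in S -> - B%:Z <= f d.
  move=> dS; suff : (`|f d| <= B)%N by lia.
  by rewrite /B (big_rem d) //= leq_addr.
have [m] := ubnP `|(f c + B%:Z)%R|%N.
elim: m c Qc cS => // m IH c Qc cS lt_m.
have [d [Qd fd dS]] := descQ c Qc; rewrite cS in dS.
by apply: (IH d Qd) => //; have := fB d (esym dS); have := fB c cS; lia.
Qed.

Section Shape.
Variables (n : nat) (F : alternating_shape n).

Definition start_front (k : nat) : int := (vertex (start_point F) (start_steps F) k).1.
Definition end_front (k : nat) : int := (vertex (end_start_point F) (end_steps F) k).1.

Lemma start_frontP : is_front n start_front.
Proof. by have := SE_front (start_point F) (start_SE F); rewrite size_start. Qed.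

Lemma end_frontP : is_front n end_front.
Proof. by have := SE_front (end_start_point F) (end_SE F); rewrite size_end. Qed.

Lemma start_edgeE (i : 'I_n) : start_edge F i = front_edge start_front i.
Proof.
by apply: nth_SE_path; rewrite ?start_SE ?size_start ?ltn_ord.
Qed.

Lemma end_edgeE (i : 'I_n) : end_edge F i = front_edge end_front i.
Proof.
by apply: nth_SE_path; rewrite ?end_SE ?size_end ?ltn_ord.
Qed.

Lemma start_le_end k : (k <= n)%N -> start_front k <= end_front k.
Proof.
move=> kn; case: (posnP k) => [->|k0].
  by rewrite /start_front /end_front /vertex !take0 /=; lia.
have [kn'|nk] := ltnP k n; first by have [? _] := @end_above_start n F k ltac:(lia); apply: ltW.
have {kn nk} -> : k = n by lia.
have := paths_close F; rewrite endpoint_EN_stairs /start_front /end_front.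
rewrite /vertex !take_oversize ?size_start ?size_end //.
rewrite /endpoint => <- /=; rewrite /start_end_point /endpoint; lia.
Qed.

(** The stair edges have gap [-1] or [n], just outside the gaps [0, ..., n - 1] of front edges. *)
Lemma boundary_cases e : in_boundary (cells F) e ->
  [\/ exists2 i, (i < n)%N & e = front_edge start_front i,
      exists2 i, (i < n)%N & e = front_edge end_front i
    | edge_gap e = -1 \/ edge_gap e = n%:Z].
Proof.
rewrite boundaryE !mem_cat => /or4P[].
- move=> /(nthP e)[i]; rewrite size_path_edges size_start => ilt <-.
  by apply: Or31; exists i => //; apply: nth_SE_path; rewrite ?start_SE ?size_start.
- by move=> /NE_stairs_gap -> ; apply: Or33; left => /=.
- move=> /(nthP e)[i]; rewrite size_path_edges size_end => ilt <-.
  by apply: Or32; exists i => //; apply: nth_SE_path; rewrite ?end_SE ?size_end.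
- move=> /EN_stairs_gap -> ; apply: Or33; right.
  have := @vertex_SE (start_point F) _ n (start_SE F).
  rewrite size_start => /(_ (leqnn _)); rewrite /start_end_point /endpoint /vertex.
  by rewrite take_oversize ?size_start // => -> /=; lia.
Qed.

Lemma start_boundary i : (i < n)%N -> in_boundary (cells F) (front_edge start_front i).
Proof.
move=> ilt; rewrite boundaryE mem_cat; apply/orP; left.
rewrite -(start_edgeE (Ordinal ilt)) /start_edge mem_nth //.
by rewrite size_path_edges size_start.
Qed.

Local Notation s := (start_front).
Local Notation e := (end_front).

Lemma boundary_front i b : (i < n)%N -> edge_gap b = i%:Z -> in_boundary (cells F) b ->
  b = front_edge s i \/ b = front_edge e i.
Proof.
move=> ilt gb /boundary_cases[[j _ bE]|[j _ bE]|]; last lia.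
  by left; rewrite bE; congr front_edge; have := front_edge_gap s j; rewrite -bE; lia.
by right; rewrite bE; congr front_edge; have := front_edge_gap e j; rewrite -bE; lia.
Qed.

Lemma inner_edge b : ~~ in_boundary (cells F) b ->
  (cell_after b \in cells F) = (cell_before b \in cells F).
Proof. by rewrite /in_boundary; do 2!case: (_ \in _). Qed.

Lemma inner_Ver i a : (i < n)%N -> a <> s i \/ a <> s i.+1 -> a <> e i \/ a <> e i.+1 ->
  ((a, a - i.+1%:Z) \in cells F) = ((a - 1, a - i.+1%:Z) \in cells F).
Proof.
move=> ilt sa ea; apply: (@inner_edge (Ver _)); apply/negP => /(@boundary_front i) /=.
by case=> //; [lia | move=> /esym/front_edge_VerP /= ; lia ..].
Qed.

Lemma inner_Hor i a : (i < n)%N -> a <> s i \/ a + 1 <> s i.+1 ->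
    a <> e i \/ a + 1 <> e i.+1 ->
  ((a, a - i%:Z) \in cells F) = ((a, a - i%:Z - 1) \in cells F).
Proof.
move=> ilt sa ea; apply: (@inner_edge (Hor _)); apply/negP => /(@boundary_front i) /=.
case=> //; [lia | move=> /esym/front_edge_HorP ..].
  by move=> /(_ _ (start_frontP)) /=; lia.
by move=> /(_ _ (end_frontP)) /=; lia.
Qed.

(** Beyond the stairs one can walk west, respectively south, forever without crossing the
    boundary. *)
Lemma cell_gap c : c \in cells F -> 0 <= c.1 - c.2 <= n%:Z.
Proof.
have far e0 : edge_gap e0 < -1 \/ n%:Z < edge_gap e0 -> ~~ in_boundary (cells F) e0.
  move=> ge0; apply/negP => /boundary_cases[[j jn eE]|[j jn eE]|]; last lia.
    by move: ge0; rewrite eE front_edge_gap; lia.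
  by move: ge0; rewrite eE front_edge_gap; lia.
move=> cF; apply/andP; split; rewrite leNgt; apply: contraL cF => cgap.
  apply: (@fset_descent _ (fun c => c.1 - c.2 < 0) (fun c => c.1)) cgap => {}c cgap.
  exists (c.1 - 1, c.2); split=> /=; [lia | lia |].
  by case: c cgap => x y /= cgap; apply: (@inner_edge (Ver (x, y))); apply: far => /=; lia.
apply: (@fset_descent _ (fun c => n%:Z < c.1 - c.2) (fun c => c.2)) cgap => {}c cgap.
exists (c.1, c.2 - 1); split=> /=; [lia | lia |].
by case: c cgap => x y /= cgap; apply: (@inner_edge (Hor (x, y))); apply: far => /=; lia.
Qed.

(** The walk goes west, or south from the diagonal [j = 0]; it stays southwest of the starting path
    and never crosses the boundary. *)
Lemma cell_ge_start k a : (0 < n)%N -> (k <= n)%N -> a < s k -> (a, a - k%:Z) \notin cells F.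
Proof.
move=> n0 kn ask.
pose Q (c : point) := exists2 j, (j <= n)%N & c.1 < s j /\ c.2 = c.1 - j%:Z.
apply: (@fset_descent _ Q (fun c => c.1 + c.2)); last by exists k.
move=> {a k kn ask} [a b] [[|j] jn [/= asj ->]].
  have := start_frontP n0; have := start_le_end (leq0n n) => se s01.
  exists (a, a - 0%:Z - 1); split=> /=; [exists 1%N => //=; lia | lia |].
  by apply: inner_Hor => //; lia.
have := start_frontP jn; have := start_le_end jn => se s01.
exists (a - 1, a - j.+1%:Z); split=> /=; [exists j => /=; lia | lia |].
by apply: inner_Ver => //; lia.
Qed.

Lemma cell_lt_end k a : (0 < n)%N -> (k <= n)%N -> e k <= a -> (a, a - k%:Z) \notin cells F.
Proof.
move=> n0 kn ask.
pose Q (c : point) := exists2 j, (j <= n)%N & e j <= c.1 /\ c.2 = c.1 - j%:Z.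
apply: (@fset_descent _ Q (fun c => - c.1 - c.2)); last by exists k.
move=> {a k kn ask} [a b] [j jn [/= asj ->]].
have [jn'|nj] := ltnP j n.
  have := end_frontP jn'; have := start_le_end jn => se s01.
  exists (a + 1, a - j%:Z); split=> /=; [exists j.+1 => /=; lia | lia |].
  have := @inner_Ver j (a + 1) jn'.
  have -> : a + 1 - j.+1%:Z = a - j%:Z by lia.
  by rewrite addrK => ->//; lia.
have [i iE] : exists i, n = i.+1 by exists n.-1; lia.
have ilt : (i < n)%N by lia.
have {jn nj}jE : j = i.+1 by lia.
subst j; have := end_frontP ilt; have := @start_le_end i.+1 ltac:(lia) => se s01.
exists (a, a - i.+1%:Z + 1); split=> /=; [exists i => /=; lia | lia |].
have := @inner_Hor i a ilt.
have -> : a - i%:Z - 1 = a - i.+1%:Z by lia.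
have -> : a - i.+1%:Z + 1 = a - i%:Z by lia.
by move=> ->//; lia.
Qed.

Lemma start_edge_cell i : (0 < n)%N -> (i < n)%N ->
  cell_after (front_edge s i) \in cells F.
Proof.
move=> n0 ilt; have := start_boundary ilt; rewrite /in_boundary.
suff /negbTE -> : cell_before (front_edge s i) \notin cells F by rewrite addbF.
have [sE|sE] := start_frontP ilt.
  rewrite front_edge_Ver //=; have -> : s i - i.+1%:Z = s i - 1 - i%:Z by lia.
  by apply: cell_ge_start => //; lia.
rewrite front_edge_Hor //=; have -> : s i - i%:Z - 1 = s i - i.+1%:Z by lia.
by apply: cell_ge_start => //; lia.
Qed.

(** Walking back west or south meets no boundary until a cell bordering the starting path is
    reached. *)
Lemma region_cell k a : (0 < n)%N -> (k <= n)%N -> s k <= a < e k ->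
  (a, a - k%:Z) \in cells F.
Proof.
(* The measure is the sum of the coordinates of the cell, shifted to be nonnegative because
   [s 0 <= a] and [k <= n]. *)
move=> n0; have [m] := ubnP `|(a + a - s 0 - s 0 + n%:Z - k%:Z)%R|%N.
elim: m k a => // m IH k a lt_m kn ask.
have s_ge j : (j <= n)%N -> s 0 <= s j.
  by move=> jn; have := @front_range n _ (start_frontP) 0 j; rewrite jn => /(_ isT); lia.
have := s_ge k kn => sk0.
case: k lt_m kn ask sk0 => [|k] lt_m kn ask sk0.
  have s1 := start_frontP n0; have e1 := end_frontP n0.
  have [sa|sa] : s 1 <= a \/ a + 1 = s 1 by lia.
    rewrite inner_Hor //; try lia.
    have -> : a - 0%:Z - 1 = a - 1%:Z by lia.
    by apply: IH => //; lia.
  have := start_edge_cell n0 n0; rewrite front_edge_Hor /=; try lia.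
  by have -> : s 0 = a by lia.
have s1 := start_frontP kn; have e1 := end_frontP kn.
have [sa|sa] : s k <= a - 1 \/ s k = a /\ s k.+1 = a by lia.
  rewrite inner_Ver //; try lia.
  have -> : a - k.+1%:Z = a - 1 - k%:Z by lia.
  by have := s_ge k (ltnW kn) => ?; apply: IH; lia.
have := start_edge_cell n0 kn; rewrite front_edge_Ver /=; try lia.
by have -> : s k = a by lia.
Qed.
End Shape.

(** * Sweeping the shape *)

Definition passing (sg : nat -> nat) (l k : nat) : nat := (\sum_(j < k) (l <= sg j))%N.

(* The number of east steps of a northeast lattice path from vertex [l] of [s] to
   vertex [k] of [x], when there is one; otherwise the number of pipes forced to
   pass by the relative position of the two vertices. *)
Definition capacity (s x : nat -> int) (l k : nat) : int :=
  Num.max (x k - s l) 0 + Num.max (s l - l%:Z - (x k - k%:Z)) 0.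

(** Vertex [k] moves by [(1, 1)], so the front passes over the cell of which it was the lower-left
    corner. *)
Definition bump_front (x : nat -> int) (k : nat) : nat -> int :=
  fun i => if i == k then x k + 1 else x i.

Definition swap_at (r : nat) (sg : nat -> nat) : nat -> nat :=
  fun i => if i == r then sg r.+1 else if i == r.+1 then sg r else sg i.

Lemma passingS sg l k : passing sg l k.+1 = (passing sg l k + (l <= sg k))%N.
Proof. by rewrite /passing big_ord_recr. Qed.

Lemma passing_swap r sg l k : k <> r.+1 -> passing (swap_at r sg) l k = passing sg l k.
Proof.
have le_r j : (j <= r)%N -> passing (swap_at r sg) l j = passing sg l j.
  elim: j => [|j IH] jr; first by rewrite /passing !big_ord0.
  by rewrite !passingS IH ?(ltnW jr) // /swap_at !ifN //; lia.
move=> kr; have [/le_r//|rk] := leqP k r.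
have {kr rk} [j ->] : exists j, k = (r + j).+2.
  by exists (k - r.+2)%N; move: kr rk; lia.
elim: j => [|j IH].
  by rewrite addn0 !passingS le_r // /swap_at !eqxx ifN ?eqxx 1?addnAC //; lia.
by rewrite addnS passingS IH [RHS]passingS /swap_at !ifN //; lia.
Qed.

Lemma bump_frontP n x k : is_front n x ->
  ((0 < k)%N -> x k.-1 = x k) -> ((k < n)%N -> x k.+1 = x k + 1) ->
  is_front n (bump_front x k).
Proof.
move=> xP left right i ilt; rewrite /bump_front.
have := xP i ilt.
have [iE|ik] := eqVneq i.+1 k.
  by subst k; have /= := left isT; rewrite ifN; lia.
by have [iE|_] := eqVneq i k; [subst i; have := right ilt; lia|].
Qed.

Lemma next_edge_before P e : cell_before (next_edge P e) = cell_after e.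
Proof. by case: e => -[x y] /=; case: (P _) => /=; congr pair; lia. Qed.

Lemma next_edge_inj P : injective (next_edge P).
Proof.
move=> e1 e2 eE; have : cell_after e1 = cell_after e2 by rewrite -!(next_edge_before P) eE.
by case: e1 e2 eE => [p|p] [q|q] /= + pq; subst q => //; case: (P _).
Qed.

Lemma front_sweep n (s e : nat -> int) (I : (nat -> int) -> Prop) :
  is_front n s -> is_front n e -> (forall k, (k <= n)%N -> s k <= e k) -> I s ->
  (forall x k, is_front n x -> (forall i, (i <= n)%N -> s i <= x i <= e i) -> I x ->
     (k <= n)%N -> x k < e k -> ((0 < k)%N -> x k.-1 = x k) ->
     ((k < n)%N -> x k.+1 = x k + 1) -> I (bump_front x k)) ->
  exists2 x, forall k, (k <= n)%N -> x k = e k & I x.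
Proof.
move=> sP eP se Is step.
suff gen d (x : nat -> int) : (\sum_(k < n.+1) `|(e k - x k)%R| < d)%N -> I x -> is_front n x ->
    (forall k, (k <= n)%N -> s k <= x k <= e k) ->
    exists2 x, forall k, (k <= n)%N -> x k = e k & I x.
  by apply: gen (ltnSn _) Is sP _ => k /se ->; rewrite lexx.
elim: d x => // d IH x lt_d Ix xP sx.
have [/forallP eq|/forallPn[k0 nk0]] := boolP [forall k : 'I_n.+1, x k == e k].
  by exists x => // k kn; apply/eqP/(eq (Ordinal (kn : (k < n.+1)%N))).
(* [f] is the sum of the coordinates of a vertex. Where it is least among vertices not yet on [e],
   the front has a corner: otherwise a neighbour of smaller sum is already on [e], and monotonicity
   forces [x k >= e k]. *)
pose f (k : nat) : int := x k + x k - k%:Z.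
have [k] : exists k : 'I_n.+1, x k != e k /\ forall j : 'I_n.+1, x j != e j -> f k <= f j.
  by case: (@arg_minP _ _ _ k0 (fun k : 'I_n.+1 => x k != e k) f nk0) => k; exists k.
case=> /eqP kP kmin; have kn : (k <= n)%N by rewrite -ltnS.
have xk : x k < e k by have := sx k kn; lia.
have kmin' j : (j <= n)%N -> f j < f k -> x j = e j.
  move=> jn; case: (eqVneq (x j) (e j)) => // xj.
  by have := kmin (Ordinal (jn : (j < n.+1)%N)) xj => /=; lia.
have left : (0 < k)%N -> x k.-1 = x k.
  move=> k0'; have lt : (k.-1 < n)%N by lia.
  have := xP _ lt; have := eP _ lt; rewrite prednK //.
  have := kmin' k.-1 ltac:(lia); rewrite /f; lia.
have right : (k < n)%N -> x k.+1 = x k + 1.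
  move=> lt; have := xP _ lt; have := eP _ lt.
  have := kmin' k.+1 lt; rewrite /f; lia.
apply: (IH (bump_front x k)); last first.
- by move=> i ilt; have := sx i ilt; rewrite /bump_front; case: eqVneq => // ->; lia.
- exact: bump_frontP.
- exact: step.
rewrite ltnS in lt_d; apply: leq_trans lt_d; rewrite (bigD1 k) //= [X in (_ <= X)%N](bigD1 k) //=.
rewrite {1}/bump_front eqxx -addSn; apply: leq_add; first lia.
apply: leq_sum => i ik; rewrite /bump_front ifN //; exact: ik.
Qed.

(** * Pipes crossing a front *)

Section Pipes.
Variables (n : nat) (n0 : (0 < n)%N) (F : alternating_shape n) (P : filling).

Local Notation s := (start_front F).
Local Notation e := (end_front F).

(** Pipes can be traced backwards: [next_edge] is injective, and it never yields a starting edge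
    from a cell of [F], as the cell before a starting edge is outside [F]. *)
Lemma on_pipe_inj (i j : 'I_n) b : on_pipe F P i b -> on_pipe F P j b -> i = j.
Proof.
have not_start b' (k : 'I_n) : cell_after b' \in cells F -> next_edge P b' <> start_edge F k.
  move=> b'F nE; have := start_boundary F (ltn_ord k); rewrite -start_edgeE -nE.
  rewrite /in_boundary next_edge_before b'F nE start_edgeE.
  by rewrite start_edge_cell.
move=> ib; elim: ib j => [|b' ib' IH b'F] j.
  move eE: (start_edge F i) => b0 jb; case: jb eE => [|b' _ b'F /esym/not_start] //.
  rewrite !start_edgeE => /(congr1 edge_gap); rewrite !front_edge_gap => -[ij].
  exact: val_inj.
move nE: (next_edge P b') => b0 jb; case: jb nE => [/not_start|b2 jb2 b2F /next_edge_inj bE] //.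
by apply: IH; rewrite bE.
Qed.

Lemma on_pipe_iter (j : 'I_n) b : on_pipe F P j b ->
  exists2 k, b = iter k (next_edge P) (start_edge F j) &
    forall i, (i < k)%N -> cell_after (iter i (next_edge P) (start_edge F j)) \in cells F.
Proof.
elim=> [|b' _ [k -> kF] b'F]; first by exists 0%N.
by exists k.+1 => // i; rewrite ltnS leq_eqVlt => /orP[/eqP->|/kF].
Qed.

Lemma terminal_edge_uniq (j : 'I_n) b b' : on_pipe F P j b -> on_pipe F P j b' ->
  cell_after b \notin cells F -> cell_after b' \notin cells F -> b = b'.
Proof.
move=> /on_pipe_iter[k -> kF] /on_pipe_iter[k' -> k'F] /negP bF /negP b'F.
by have [/k'F|/kF|->] := ltngtP k k'.
Qed.

Lemma end_edge_terminal (i : 'I_n) : cell_after (end_edge F i) \notin cells F.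
Proof.
rewrite end_edgeE; have [eE|eE] := end_frontP F (ltn_ord i).
  by rewrite front_edge_Ver //= -eE; apply: cell_lt_end.
by rewrite front_edge_Hor //=; apply: cell_lt_end => //; apply: ltnW.
Qed.

Variables (w : 'S_n) (Pw : exit_permutation F P w).

(** A pipe has a single edge followed by no cell, and the exit permutation puts it on the ending
    path. So no pipe leaves through a stair. *)
Lemma exits_through_end (j : 'I_n) b : on_pipe F P j b -> cell_after b \notin cells F ->
  0 <= edge_gap b < n%:Z.
Proof.
move=> jb bF; have := Pw ((w^-1)%g j); rewrite permKV => /(terminal_edge_uniq jb).
move=> /(_ bF (end_edge_terminal _)) ->.
by rewrite end_edgeE front_edge_gap; have := ltn_ord ((w^-1)%g j); lia.
Qed.

(* A cell along a stair carries a single pipe, which would leave through the stair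
   if it went straight. *)
Lemma NW_stair_contact (j : 'I_n) a : (a, a) \in cells F -> on_pipe F P j (Hor (a, a)) ->
  P (a, a) = Contact.
Proof.
move=> aF ja; case Pa: (P (a, a)) => //; exfalso.
have jb := on_pipe_next ja aF; rewrite /= Pa /north_side /= in jb.
have := exits_through_end jb; rewrite /=.
suff aF' : (a, a + 1) \notin cells F by move=> /(_ aF'); lia.
by apply/negP => /cell_gap /=; lia.
Qed.

Lemma SE_stair_contact (j : 'I_n) a : (a, a - n%:Z) \in cells F ->
  on_pipe F P j (Ver (a, a - n%:Z)) -> P (a, a - n%:Z) = Contact.
Proof.
move=> aF ja; case Pa: (P (a, a - n%:Z)) => //; exfalso.
have jb := on_pipe_next ja aF; rewrite /= Pa /east_side /= in jb.
have := exits_through_end jb; rewrite /=.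
suff aF' : (a + 1, a - n%:Z) \notin cells F by move=> /(_ aF'); lia.
by apply/negP => /cell_gap /=; lia.
Qed.

(** [track_all] expresses in counting form that [sg] permutes the pipes. *)
Record tracks (x : nat -> int) (sg : nat -> nat) : Prop := Tracks {
  track_pipe : forall i, (i < n)%N ->
    exists2 j : 'I_n, sg i = j & on_pipe F P j (front_edge x i);
  track_cap : forall l k, (l <= n)%N -> (k <= n)%N ->
    (passing sg l k)%:Z <= capacity s x l k;
  track_all : forall l, (l <= n)%N -> passing sg l n = (n - l)%N
}.

Lemma tracks_lt x sg i : tracks x sg -> (i < n)%N -> (sg i < n)%N.
Proof. by move=> /track_pipe tr /tr[j -> _]. Qed.

Lemma tracks_start : tracks s id.
Proof.
have idE l k : passing id l k = (k - l)%N.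
  elim: k => [|k IH]; first by rewrite /passing big_ord0.
  by rewrite passingS IH; lia.
split=> [i ilt|l k ln kn|l ln]; last 2 first.
- by rewrite idE /capacity; lia.
- exact: idE.
exists (Ordinal ilt) => //.
rewrite -(start_edgeE F (Ordinal ilt)); exact: on_pipe_start.
Qed.

Section Step.
Variables (x : nat -> int) (sg : nat -> nat) (k : nat).
Hypotheses (xP : is_front n x) (sx : forall i, (i <= n)%N -> s i <= x i <= e i).
Hypotheses (tr : tracks x sg) (kn : (k <= n)%N) (xk : x k < e k).
Hypotheses (left : (0 < k)%N -> x k.-1 = x k) (right : (k < n)%N -> x k.+1 = x k + 1).

Lemma bump_cell : (x k, x k - k%:Z) \in cells F.
Proof. by apply: region_cell => //; have := sx kn; lia. Qed.

Lemma bump_edge i : i <> k -> i.+1 <> k ->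
  front_edge (bump_front x k) i = front_edge x i.
Proof. by move=> /eqP/negbTE ik /eqP/negbTE i1k; rewrite /front_edge /bump_front ik i1k. Qed.

Lemma capacity_bump l j : j <> k -> capacity s (bump_front x k) l j = capacity s x l j.
Proof. by move=> jk; rewrite /capacity /bump_front ifN //; apply/eqP. Qed.

Lemma west_edge : (0 < k)%N -> front_edge x k.-1 = Ver (x k, x k - k%:Z).
Proof. by move=> k0; rewrite front_edge_Ver prednK // left. Qed.

Lemma south_edge : (k < n)%N -> front_edge x k = Hor (x k, x k - k%:Z).
Proof. by move=> kn'; rewrite front_edge_Hor // right. Qed.

Lemma bump_north_edge : (0 < k)%N ->
  front_edge (bump_front x k) k.-1 = Hor (x k, x k - k%:Z + 1).
Proof.
move=> k0; have := left k0; rewrite front_edge_Hor /bump_front ?prednK ?eqxx ?ifN //; try lia.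
by move=> ->; congr (Hor (_, _)); lia.
Qed.

Lemma bump_east_edge : (k < n)%N ->
  front_edge (bump_front x k) k = Ver (x k + 1, x k - k%:Z).
Proof.
move=> k0; have := right k0; rewrite front_edge_Ver /bump_front ?eqxx ?ifN //; try lia.
by move=> _; congr (Ver (_, _)); lia.
Qed.

Lemma tracks_stair_step : k = 0%N \/ k = n -> tracks (bump_front x k) sg.
Proof.
move=> kE; have [trp trc tra] := tr; have cF := bump_cell.
split=> [i ilt|l j ln jn|] //; last first.
  case: (eqVneq j k) => [->|/eqP jk]; last by rewrite capacity_bump //; exact: trc.
  case: kE => ->; first by rewrite /passing big_ord0 /capacity; lia.
  (* At [k = n] the two quantities under the maxima add up to [n - l], the number of pipes
     counted. *)
  by rewrite tra // /capacity; lia.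
have [i' iE ip] := trp i ilt; exists i' => //.
have [kE'|kE'] := kE.
  have [i0|i0] := eqVneq i 0%N; last by rewrite bump_edge //; lia.
  have ik : i = k by rewrite i0.
  rewrite ik south_edge in ip; last lia.
  rewrite ik bump_east_edge; last lia.
  have := on_pipe_next ip cF; move: ip cF.
  have -> : x k - k%:Z = x k by lia.
  by move=> /= ip cF; rewrite (NW_stair_contact cF ip).
have [ik|ik] := eqVneq i.+1 k; last by rewrite bump_edge //; lia.
have i1 : i = k.-1 by lia.
rewrite i1 west_edge in ip; last lia.
rewrite i1 bump_north_edge; last lia.
have := on_pipe_next ip cF; move: ip cF; rewrite kE' => /= ip cF.
by rewrite (SE_stair_contact cF ip).
Qed.

End Step.

Section InnerStep.
Variables (x : nat -> int) (sg : nat -> nat) (r : nat).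
Hypotheses (xP : is_front n x) (sx : forall i, (i <= n)%N -> s i <= x i <= e i).
Hypotheses (tr : tracks x sg) (rn : (r.+1 < n)%N) (xk : x r.+1 < e r.+1).
Hypotheses (left : x r = x r.+1) (right : x r.+2 = x r.+1 + 1).

Local Notation c := (x r.+1, x r.+1 - r.+1%:Z).

Definition step_pipes : nat -> nat := if P c is Cross then swap_at r sg else sg.

Lemma passing_step l j : j <> r.+1 -> passing step_pipes l j = passing sg l j.
Proof. by rewrite /step_pipes; case: (P c) => // jr; apply: passing_swap. Qed.

Lemma inner_cell : c \in cells F.
Proof. by apply: bump_cell => //; apply: ltnW. Qed.

Lemma inner_west : exists2 j : 'I_n, sg r = j & on_pipe F P j (west_side c).
Proof.
have [j jE jp] := track_pipe tr (ltnW rn); exists j => //.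
by rewrite /west_side -(@west_edge x r.+1 (fun _ => left) isT).
Qed.

Lemma inner_south : exists2 j : 'I_n, sg r.+1 = j & on_pipe F P j (south_side c).
Proof.
have [j jE jp] := track_pipe tr rn; exists j => //.
by rewrite /south_side -(@south_edge x r.+1 (fun _ => right) rn).
Qed.

Lemma tracks_inner_step : tracks (bump_front x r.+1) step_pipes.
Proof.
have [trp trc tra] := tr; have cF := inner_cell.
have [jw jwE jwp] := inner_west; have [js jsE jsp] := inner_south.
split=> [i ilt|l j ln jn|l ln]; last 2 first.
- case: (eqVneq j r.+1) => [jE|/eqP jk]; last first.
    by rewrite capacity_bump // passing_step //; exact: trc.
  have sx1 := sx jn; have := start_frontP F.
  (* If [s l <= x r.+1], the new capacity exceeds that of gap [r] by one and [h1] suffices.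
     Otherwise [l > r.+1], the capacity of gap [r.+2] is zero and [h2] suffices. *)
  have h1 : (passing step_pipes l r.+1 <= passing sg l r + 1)%N.
    by rewrite passingS passing_step; [rewrite leq_add2l leq_b1 | lia].
  have h2 : (passing step_pipes l r.+1 <= passing sg l r.+2)%N.
    by rewrite -(@passing_step l r.+2) 1?(passingS _ _ r.+1); [exact: leq_addr | lia].
  have := trc l r ln ltac:(lia); have := trc l r.+2 ln ltac:(lia).
  rewrite jE /capacity /bump_front eqxx left right => b2 b1 /front_range sP.
  have [lr|rl] := leqP l r.+1.
    have := sP l r.+1 ltac:(lia); subst j; lia.
  have := sP r.+1 l ltac:(lia); subst j; lia.
- by rewrite passing_step; [exact: tra | lia].
have nextw := on_pipe_next jwp cF; have nexts := on_pipe_next jsp cF.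
have north := bump_north_edge (ltnW rn) xk (fun _ => left) (fun _ => right) isT.
have east := bump_east_edge (ltnW rn) xk (fun _ => left) (fun _ => right) rn.
have [ir|ir] := eqVneq i r.
  rewrite ir; move: nextw nexts; rewrite north /step_pipes /=.
  case: (P c) => nextw nexts; last by exists jw.
  by exists js => //; rewrite /swap_at eqxx.
have [ir'|ir'] := eqVneq i r.+1.
  rewrite ir'; move: nextw nexts; rewrite east /step_pipes /=.
  case: (P c) => nextw nexts; last by exists js.
  by exists jw => //; rewrite /swap_at eqxx ifN //; lia.
rewrite bump_edge; [|lia|lia].
have [i' iE ip] := trp i ilt; exists i' => //.
by rewrite /step_pipes; case: (P c) => //; rewrite /swap_at !ifN.
Qed.
End InnerStep.
End Pipes.

(** * Noninversions are joined by contact paths *)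

(** In general the two sides differ by the number of pipes in the box. *)
Lemma passing_box sg l2 l j j2 : (l2 <= l)%N -> (j <= j2)%N -> empty_box sg l2 l j j2 ->
  (passing sg l2 j2 + passing sg l j = passing sg l j2 + passing sg l2 j)%N.
Proof.
move=> l2l; elim: j2 => [|j2 IH]; first by rewrite leqn0 => /eqP ->; lia.
rewrite leq_eqVlt => /orP[/eqP <- _|jj2 box]; first lia.
have := IH ltac:(lia) (fun i iP => box i ltac:(lia)); rewrite !passingS.
by have := box j2 ltac:(lia); lia.
Qed.

Lemma passing_lt_left sg l k i : (i < k)%N -> (sg i < l)%N -> (passing sg l k < k)%N.
Proof.
have le j : (passing sg l j <= j)%N.
  by elim: j => [|j IH]; rewrite ?passingS /passing ?big_ord0 //; move: IH; rewrite /passing; lia.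
elim: k => // k IH; rewrite ltnS leq_eqVlt passingS => /orP[/eqP -> sgl|ik sgl].
  by have := le k; lia.
by have := IH ik sgl; lia.
Qed.

Lemma passing_lt_right sg l k i n : (k <= i < n)%N -> (l <= sg i)%N ->
  (passing sg l k < passing sg l n)%N.
Proof.
have mono j j' : (j <= j')%N -> (passing sg l j <= passing sg l j')%N.
  elim: j' => [|j' IH]; first by rewrite leqn0 => /eqP ->.
  by rewrite leq_eqVlt => /orP[/eqP -> //|/IH]; rewrite passingS; lia.
move=> /andP[ki ilt] lsg; have := mono _ _ ki; have := mono _ _ ilt.
by rewrite passingS lsg; lia.
Qed.

(** Each summand of [capacity] is a convex function of the difference of two sequences monotone in
    the same direction. *)
Lemma capacity_submod n s x l2 l j j2 : is_front n s -> is_front n x ->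
  (l2 <= l <= n)%N -> (j <= j2 <= n)%N ->
  capacity s x l2 j + capacity s x l j2 <= capacity s x l2 j2 + capacity s x l j.
Proof.
move=> /front_range sP /front_range xP lP jP.
by have := sP l2 l lP; have := xP j j2 jP; rewrite /capacity; lia.
Qed.

(** * The separation invariant of the sweep *)

Section Separation.
Variables (n : nat) (n0 : (0 < n)%N) (F : alternating_shape n) (P : filling).

Local Notation s := (start_front F).
Local Notation e := (end_front F).

Definition tight (x : nat -> int) (sg : nat -> nat) (l k : nat) : bool :=
  (l <= n)%N && ((passing sg l k)%:Z == capacity s x l k).

Section Moves.
Variables (x : nat -> int) (sg : nat -> nat).
Hypotheses (xP : is_front n x) (tr : tracks F P x sg).

(** Going back over a south step does not raise the capacity, and the pipe dropped was not
    counted. *)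
Lemma tight_north l r : (r.+1 <= n)%N -> x r = x r.+1 ->
  tight x sg l r.+1 -> (sg r < l)%N -> tight x sg l r.
Proof.
move=> rn xr /andP[ln /eqP]; rewrite /tight ln passingS /capacity /= => pE sl.
by have := track_cap tr ln (ltnW rn); rewrite /capacity; lia.
Qed.

(** An east step raises the capacity by at most one, and the pipe gained is counted. *)
Lemma tight_east l r : (r.+1 <= n)%N -> x r.+1 = x r + 1 ->
  tight x sg l r -> (l <= sg r)%N -> tight x sg l r.+1.
Proof.
move=> rn xr /andP[ln /eqP]; rewrite /tight ln passingS /capacity /= => pE sl.
by have := track_cap tr ln rn; rewrite passingS /capacity; lia.
Qed.

(** Over an empty box the counts are modular while the capacities satisfy [capacity_submod], so the
    bounds at the two exchanged pairs must be equalities. *)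
Lemma tight_uncross l l2 j j2 : tight x sg l2 j2 -> tight x sg l j ->
  (l2 < l < n)%N -> (j < j2 < n)%N -> empty_box sg l2 l j j2 ->
  tight x sg l j2 /\ tight x sg l2 j.
Proof.
move=> /andP[l2n /eqP t2] /andP[ln /eqP t] lP jP.
move=> /(passing_box (ltac:(lia) : (l2 <= l)%N) (ltac:(lia) : (j <= j2)%N)).
have := @capacity_submod n s x l2 l j j2 (start_frontP F) xP ltac:(lia) ltac:(lia).
have := track_cap tr l2n (ltac:(lia) : (j <= n)%N).
have := track_cap tr ln (ltac:(lia) : (j2 <= n)%N).
by rewrite /tight l2n ln /=; lia.
Qed.
End Moves.

Variables (w : 'S_n) (Pw : reduced_pipe_dream F w P) (A : pred nat).
Hypothesis A_closed : forall a b : 'I_n, contact_arc F P a b -> A a -> A b.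

(** The condition [y < x k] places the crossing behind the front, hence apart from any cell still to
    be swept. *)
Definition inversions_crossed (x : nat -> int) (sg : nat -> nat) : Prop :=
  forall i i' (a b : 'I_n), (i < i' < n)%N -> sg i = a -> sg i' = b -> (b < a)%N ->
    exists k y, y < x k /\ cross_at F P a b (y, y - k%:Z).

Record invariant (x : nat -> int) (sg : nat -> nat) : Prop := Invariant {
  inv_tracks : tracks F P x sg;
  inv_separating : separating n sg A (tight x sg);
  inv_crossed : inversions_crossed x sg
}.

Lemma invariant_start : invariant s id.
Proof.
split; [exact: tracks_start | | by move=> i i' a b iP <- <-; lia].
(* On the starting front this pair is one vertex taken twice: no pipe is counted and the capacity is
   zero. *)
move=> m m' mm' m'n _ _ _; exists m.+1, m.+1; split; [|lia|lia].
rewrite /tight (leq_trans mm') 1?ltnW //=; apply/eqP.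
have -> : passing id m.+1 m.+1 = 0%N.
  by rewrite /passing big1 // => i _; have := ltn_ord i; lia.
by rewrite /capacity; lia.
Qed.

Lemma le_bump x k j : x j <= bump_front x k j.
Proof. by rewrite /bump_front; case: eqP => [->|_]; lia. Qed.

Section Step.
Variables (x : nat -> int) (sg : nat -> nat).
Hypotheses (xP : is_front n x) (sx : forall i, (i <= n)%N -> s i <= x i <= e i).
Hypothesis inv : invariant x sg.

Lemma invariant_stair_step k : (k <= n)%N -> x k < e k ->
  ((0 < k)%N -> x k.-1 = x k) -> ((k < n)%N -> x k.+1 = x k + 1) ->
  k = 0%N \/ k = n -> invariant (bump_front x k) sg.
Proof.
have [tr sep crossed] := inv; move=> kn xk left right kE; split.
- exact: (tracks_stair_step n0 Pw.1).
- move=> m m' mm' m'n sgm Am nAm'.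
  have [l [j [Tlj lP jP]]] := sep m m' mm' m'n sgm Am nAm'.
  exists l, j; split=> //; rewrite /tight capacity_bump //; lia.
- move=> i i' a b iP ia ib ba; have [k' [y [yx cr]]] := crossed i i' a b iP ia ib ba.
  by exists k', y; split=> //; apply: lt_le_trans yx (le_bump _ _ _).
Qed.

Section Inner.
Variable r : nat.
Hypotheses (rn : (r.+1 < n)%N) (xk : x r.+1 < e r.+1).
Hypotheses (left : x r = x r.+1) (right : x r.+2 = x r.+1 + 1).

Local Notation c := (x r.+1, x r.+1 - r.+1%:Z).

(** Two pipes already inverted have crossed behind the front; crossing again at [c] would contradict
    reducedness. *)
Lemma no_double_crossing : P c = Cross -> (sg r <= sg r.+1)%N.
Proof.
have [tr sep crossed] := inv; move=> Pc; rewrite leqNgt; apply/negP => inverted.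
have cF := inner_cell n0 sx rn xk left right.
have [a aE ap] := inner_west tr rn left; have [b bE bp] := inner_south tr rn right.
have ba : (b < a)%N by rewrite -aE -bE.
have [k [y [yx cr]]] := crossed r r.+1 a b ltac:(lia) aE bE ba.
have cr' : cross_at F P a b c by split=> //; constructor.
have ab : a <> b by move=> ab; rewrite ab ltnn in ba.
have [yE] := Pw.2 a b _ _ ab cr cr'; move=> kE.
have kr : k = r.+1 by lia.
by move: yx; rewrite kr; lia.
Qed.

Lemma contact_closed : P c = Contact -> A (sg r) -> A (sg r.+1).
Proof.
have [tr sep crossed] := inv; move=> Pc.
have cF := inner_cell n0 sx rn xk left right.
have [a -> ap] := inner_west tr rn left; have [b -> bp] := inner_south tr rn right.
by apply: A_closed; exists c.
Qed.

Lemma invariant_inner_step : invariant (bump_front x r.+1) (step_pipes P x sg r).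
Proof.
have [tr sep crossed] := inv.
(* [q] sends a position on the new front to the position of the same pipe on the old one. *)
pose q i := if P c is Cross then swap_at r id i else i.
have sgE i : step_pipes P x sg r i = sg (q i).
  by rewrite /step_pipes /q; case: (P c) => //; rewrite /swap_at; case: ifP => // _; case: ifP.
have qP m m' : (m < m' < n)%N -> ~ (P c = Cross /\ m = r /\ m' = r.+1) ->
    (q m < q m' < n)%N /\ (forall j, j <> r.+1 -> (q m < j <= q m')%N -> (m < j <= m')%N).
  rewrite /q /swap_at; case: (P c) => mm' mr; last by split.
  have {}mr : ~ (m = r /\ m' = r.+1) by move=> ?; apply: mr.
  move: mm' mr; case: (m =P r) => ?; case: (m =P r.+1) => ?;
    case: (m' =P r) => ?; case: (m' =P r.+1) => ? /= *; split=> *; lia.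
split.
- exact: tracks_inner_step.
- move=> m m' mm' m'n; rewrite !sgE => sgm Am nAm'.
  have [||/andP[qmm qmn] qj] := @qP m m'; first lia.
    move=> [Pc [mE m'E]]; have := no_double_crossing Pc.
    move: sgm; rewrite mE m'E /q Pc /swap_at !eqxx ifN; lia.
  have sg_n i : (i < n)%N -> (sg i < n)%N by apply: tracks_lt tr.
  (* The excepted pair does not arise: a cross reverses the order of its two pipes, and at a contact
     [A] is closed. *)
  have mr : ~ (q m = r /\ q m' = r.+1).
    case Pc : (P c); rewrite /q Pc /swap_at /=.
      by case: (m =P r) => ?; case: (m' =P r) => ?; case: (m =P r.+1) => ?;
         case: (m' =P r.+1) => ? /=; lia.
    move=> [mE m'E]; move: Am nAm'; rewrite /q Pc mE m'E => Am.
    by rewrite contact_closed.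
  have ordA : (sg r.+1 < sg r)%N -> A (sg r) -> A (sg r.+1).
    move=> sgr; apply: contact_closed; case Pc: (P c) => //.
    by have := no_double_crossing Pc; lia.
  have [l [j [Tlj lP jP jr]]] := separated_avoiding sg_n sep rn
    (fun l => tight_north tr (l := l) (ltnW rn) left)
    (fun l => tight_east tr (l := l) rn right)
    (fun l l2 j j2 => tight_uncross xP tr (l := l) (l2 := l2) (j := j) (j2 := j2))
    ordA qmm qmn sgm Am nAm' mr.
  exists l, j; rewrite !sgE; split; [|by []|exact: qj].
  by rewrite /tight passing_step // capacity_bump.
move=> i i' a b iP; rewrite !sgE => ia ib ba.
case: (classic (P c = Cross /\ i = r /\ i' = r.+1)) => [[Pc [iE i'E]]|ni].
  exists r.+1, (x r.+1); split; first by rewrite /bump_front eqxx; lia.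
  have [a' aE ap] := inner_west tr rn left; have [b' bE bp] := inner_south tr rn right.
  move: ia ib; rewrite iE i'E /q Pc /swap_at !eqxx ifN ?aE ?bE; last lia.
  move=> /val_inj <- /val_inj <-; split=> //; first exact: inner_cell.
  by constructor 2.
have [qi _] := qP i i' iP ni.
have [k' [y [yx cr]]] := crossed (q i) (q i') a b qi ia ib ba.
by exists k', y; split=> //; apply: lt_le_trans yx (le_bump _ _ _).
Qed.
End Inner.
End Step.

Lemma invariant_end : exists sg : nat -> nat, [/\ forall i : 'I_n, sg i = w i,
  separating n sg A (tight e sg),
  forall l k, (l <= n)%N -> (k <= n)%N -> (passing sg l k)%:Z <= capacity s e l k &
  forall l, (l <= n)%N -> passing sg l n = (n - l)%N].
Proof.
pose I x := exists sg, invariant x sg.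
have step x k : is_front n x -> (forall i, (i <= n)%N -> s i <= x i <= e i) -> I x ->
    (k <= n)%N -> x k < e k -> ((0 < k)%N -> x k.-1 = x k) ->
    ((k < n)%N -> x k.+1 = x k + 1) -> I (bump_front x k).
  move=> xP sx [sg inv] kn xk left right.
  have [kE|[k0 kn']] : (k = 0%N \/ k = n) \/ (0 < k)%N /\ (k < n)%N by lia.
    by exists sg; apply: invariant_stair_step.
  case: k k0 kn xk left right kn' => // r _ _ xk left right rn.
  exists (step_pipes P x sg r); apply: invariant_inner_step => //.
    exact: left.
  exact: right.
have Is : I s by exists id; apply: invariant_start.
have [x xe [sg [[trp trc tra] sep _]]] :=
  front_sweep (start_frontP F) (end_frontP F) (@start_le_end n F) Is step.
have capE l k : (k <= n)%N -> capacity s x l k = capacity s e l k.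
  by move=> kn; rewrite /capacity xe.
exists sg; split=> //.
- move=> i; have [j -> jp] := trp i (ltn_ord i); congr nat_of_ord.
  apply: (on_pipe_inj n0 jp); move: (Pw.1 i); rewrite end_edgeE.
  by rewrite /front_edge !xe // ltnW.
- move=> m m' mm' m'n sgm Am nAm'; have [l [j [Tlj lP jP]]] := sep m m' mm' m'n sgm Am nAm'.
  by exists l, j; split=> //; rewrite /tight -capE //; lia.
- by move=> l k ln kn; rewrite -capE //; apply: trc.
Qed.
End Separation.

Lemma noninversion_contact_path n (F : alternating_shape n) (w : 'S_n) (P : filling) (a b : 'I_n) :
  complete F -> reduced_pipe_dream F w P -> noninversion w a b ->
  clos_trans _ (contact_arc F P) a b.
Proof.
move=> [Z Zw0] Pw [ab wab].
have n0 : (0 < n)%N := leq_ltn_trans (leq0n _) (ltn_ord a).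
apply: NNPP => not_ab.
pose reach (p : nat) := exists2 j : 'I_n, p = j & j = a \/ clos_trans _ (contact_arc F P) a j.
pose A p : bool := if excluded_middle_informative (reach p) then true else false.
have AP p : reflect (reach p) (A p).
  by rewrite /A; case: excluded_middle_informative => ?; constructor.
have A_closed (c d : 'I_n) : contact_arc F P c d -> A c -> A d.
  move=> cd /AP[j /val_inj <- ac]; apply/AP; exists d => //; right.
  by case: ac cd => [->|ac] cd; [apply: t_step | apply: t_trans ac (t_step _ _ _ _ cd)].
have [sg [sgw sep _ sgn]] := invariant_end n0 Pw A_closed.
(* Only the capacity bound is wanted for the longest permutation, so a trivial closed set will
   do. *)
have [sz [szw _ szc _]] := @invariant_end n n0 F Z _ Zw0 predT (fun _ _ _ _ => isT).
have sga : sg ((w^-1)%g a) = a by rewrite sgw permKV.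
have sgb : sg ((w^-1)%g b) = b by rewrite sgw permKV.
have Aa : A a by apply/AP; exists a => //; left.
have nAb : ~~ A b.
  apply/AP => -[j /val_inj <- []// ba]; by rewrite ba ltnn in ab.
have := sep _ _ wab (ltn_ord _); rewrite /separated sga sgb.
case/(_ ab Aa nAb) => l [k [/andP[ln /eqP tlk]]].
move=> lP kP; have kn : (k <= n)%N by have := ltn_ord ((w^-1)%g b); lia.
have := szc l k ln kn; rewrite -tlk lez_nat leqNgt => /negP; apply.
(* Pipe [a] exits left of gap [k] with [a < l], and [b >= l] exits right of it, so the count for [w]
   is below both [k] and [n - l]. *)
have := @passing_lt_left sg l k ((w^-1)%g a); rewrite sga => /(_ ltac:(lia) ltac:(lia)) lt_k.
have := @passing_lt_right sg l k ((w^-1)%g b) n; rewrite sgb ltn_ord sgn // => lt_nl.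
have {}lt_nl := lt_nl ltac:(lia) ltac:(lia).
(* The longest permutation attains the smaller of these two bounds. *)
suff -> : passing sz l k = minn k (n - l) by lia.
elim: k kn {tlk kP lt_k lt_nl} => [|k IH] kn; first by rewrite /passing big_ord0 min0n.
by have := szw (Ordinal kn); rewrite permE passingS (IH (ltnW kn)) /= => ->; lia.
Qed.

Theorem theorem3p2 (n : nat) (hn : (2 <= n)%N) (F : alternating_shape n)
    (hF : complete F) (w : 'S_n) (P : filling) :
  reduced_pipe_dream F w P -> acyclic F P -> strongly_acyclic F P w.
Proof.
move=> Pw acyc; suff sub a b : clos_trans _ (extended_contact_arc F P w) a b ->
    clos_trans _ (contact_arc F P) a b by move=> a /sub/acyc.
elim=> {a b} [a b [|ab]|a b c _ ab _ bc].
- exact: t_step.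
- exact: noninversion_contact_path Pw ab.
- exact: t_trans ab bc.
Qed.
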